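(* Let $N$ and $d$ be integers with $1 \le d \le N$, and let $E$ be a linear subspace of $\mathbb{R}^N$ of dimension $d$. Let $\lambda, \lambda'$ be real numbers. (i) If $\lambda \|x\|_2 \le \|x\|_1$ for all $x \in E$, then $$\lambda \le \sqrt{\frac{2}{\pi}}\,\sqrt{N}\cdot \frac{\sqrt{d}}{\mu_d}.$$ (ii) If $\|x\|_1 \le \lambda' \|x\|_2$ for all $x \in E$, then $$\lambda' \ge \sqrt{d}.$$
   Context: For $x = (x(1),\ldots,x(N)) \in \mathbb{R}^N$, $\|x\|_1 = \sum_{k=1}^N |x(k)|$ and $\|x\|_2 = \big(\sum_{k=1}^N |x(k)|^2\big)^{1/2}$ (unnormalized counting measure). For a positive integer $d$, $\mu_d$ denotes the expected Euclidean length of a standard Gaussian vector in $\mathbb{R}^d$: if $g_1,\ldots,g_d$ are independent standard real normal random variables, then $$\mu_d := \mathbb{E}\,(|g_1|^2 + \cdots + |g_d|^2)^{1/2} = \sqrt{2}\,\frac{\Gamma((d+1)/2)}{\Gamma(d/2)}.$$ *)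

(* Defs.v *)
From HB Require Import structures.
From mathcomp Require Import all_boot all_order all_algebra.
From mathcomp Require Import all_classical all_reals all_analysis.

Set Implicit Arguments.
Unset Strict Implicit.
Unset Printing Implicit Defensive.

Import Order.TTheory GRing.Theory Num.Theory.
Import numFieldNormedType.Exports.

Local Open Scope classical_set_scope.
Local Open Scope ring_scope.

(* The library norm on 'rV[R]_n is the sup norm, hence these two. *)
Definition l1norm (R : realType) (n : nat) (x : 'rV[R]_n) : R :=
  \sum_(k < n) `|x 0 k|.

Definition l2norm (R : realType) (n : nat) (x : 'rV[R]_n) : R :=
  Num.sqrt (\sum_(k < n) `|x 0 k| ^+ 2).

Section iid_prob.
Context d (T : measurableType d) (R : realType).

Definition tcons (n : nat) (z : T * n.-tuple T) : n.+1.-tuple T :=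
  [tuple of z.1 :: z.2].

Lemma measurable_tcons (n : nat) :
  measurable_fun [set: T * n.-tuple T] (@tcons n).
Proof. exact: measurable_cons. Qed.

HB.instance Definition _ (n : nat) :=
  isMeasurableFun.Build _ _ _ _ (@tcons n) (@measurable_tcons n).

(* The n-fold product P \x ... \x P, carried over to n.-tuple T. *)
Fixpoint iid_prob (P : probability T R) (n : nat) :
    probability (n.-tuple T) R :=
  match n with
  | 0 => dirac ([tuple] : 0.-tuple T)
  | m.+1 => distribution (P \x iid_prob P m)%E (@tcons m)
  end.

Lemma iid_prob_box (P : probability T R) (n : nat) (A : 'I_n -> set T) :
  (forall i, measurable (A i)) ->
  iid_prob P n [set t | forall i, A i (tnth t i)] = (\prod_(i < n) P (A i))%E.
Proof.
elim: n A => [|n IH] A mA.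
  by rewrite big_ord0 /= diracE mem_set//= => -[].
rewrite big_ord_recl /= -IH//.
rewrite /distribution /pushforward -product_measure1E//; last first.
  rewrite [X in measurable X](_ : _ =
      \bigcap_(i in [set: 'I_n]) ((@tnth _ T ^~ i) @^-1` A (lift ord0 i))).
    apply: fin_bigcap_measurable => // i _.
    by rewrite -[X in measurable X]setTI; exact: measurable_tnth.
  by apply/seteqP; split => [t h i _|t h i]; [exact: h|exact: (h i I)].
congr (_ _); apply/seteqP; split => -[x t] /=.
  move=> h; split; first exact: (h ord0).
  by move=> i; have := h (lift ord0 i); rewrite tnthS.
move=> [h0 h] i; have [j ->|->] := unliftP ord0 i; last exact: h0.
by rewrite tnthS; exact: h.
Qed.

End iid_prob.

Definition gaussian (R : realType) (d : nat) :
    probability (d.-tuple (measurableTypeR R)) R :=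
  iid_prob (normal_prob (0 : R) 1) d.

(* The expectation is finite (sqrt (\sum g_i^2) <= \sum `|g_i|), so fine is
   harmless. *)
Definition mu (R : realType) (d : nat) : R :=
  fine ('E_(gaussian R d)[fun g => l2norm (\row_i tnth g i)])%E.

(* Main.v *)
Require Import Defs.
From mathcomp Require Import all_boot all_order all_algebra.
From mathcomp Require Import all_classical all_reals all_analysis.
From mathcomp Require Import measurable_realfun.
From mathcomp Require Import ring lra.

(** The subspace [E] has an orthonormal basis, given by the rows of a
    matrix [B] with [B *m B^T = 1%:M]; [y |-> y *m B] is then an isometry from
    [d]-dimensional space onto [E].  Write [u_k] for the columns of [B], so
    that the [k]-th coordinate of [y *m B] is the inner product of [y] and
    [u_k].  The sum of the [|u_k|^2] is the trace of the orthogonal projection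
    onto [E], which is [d] ([sum_sqr_l2norm_columns]).  Both bounds come from
    averaging over suitable vectors of [E].

    For the bound on [lambda], let [y] be a standard Gaussian vector.  Integrating the
    hypothesis at [y *m B] gives
    [lambda * mu d <= \sum_k E |<y, u_k>|].  A linear form of a Gaussian vector
    is a one-dimensional Gaussian ([integral_gaussian_linear]), so
    [E |<y, u_k>| = sqrt (2 / pi) * |u_k|], and by the Cauchy-Schwarz inequality
    [\sum_k |u_k| <= sqrt N * sqrt d].  The distribution of a linear form is
    found by induction on the dimension; the inductive step says that the sum of
    two independent centred Gaussians is Gaussian ([integral_normal_add]), which
    amounts to completing a square in the exponent ([normal_pdf_mul]).

    For the bound on [lambda'], project a vector [e] of signs onto [E]: put [y = \sum_k e_k u_k]
    and [x = y *m B].  For random signs the mean of [|y|^2] is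
    [\sum_k |u_k|^2 = d], so some choice of signs has [|y|^2 >= d]
    ([exists_signs_sum_sqr_le]).  For that choice
    [|y|^2 = <x, e> <= l1norm x <= lambda' * |x| = lambda' * |y|], whence
    [sqrt d <= |y| <= lambda']. *)

Import Order.TTheory GRing.Theory Num.Theory.
Import numFieldNormedType.Exports.

Set Implicit Arguments.
Unset Strict Implicit.

Local Open Scope classical_set_scope.
Local Open Scope ring_scope.

(** * Euclidean geometry of row vectors *)

Section Geometry.
Context {R : realType}.

Lemma l2norm_ge0 n (x : 'rV[R]_n) : 0 <= l2norm x.
Proof. exact: sqrtr_ge0. Qed.

Lemma sqr_l2norm n (x : 'rV[R]_n) : l2norm x ^+ 2 = (x *m x^T) 0 0.
Proof.
rewrite /l2norm sqr_sqrtr; last by apply: sumr_ge0 => k _; exact: exprn_ge0.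
by rewrite mxE; apply: eq_bigr => k _; rewrite !mxE real_normK ?num_real ?expr2.
Qed.

Lemma l2norm_eq0 n (x : 'rV[R]_n) : (l2norm x == 0) = (x == 0).
Proof.
apply/eqP/eqP => [x0|->]; last first.
  by rewrite /l2norm big1 ?sqrtr0// => k _; rewrite !mxE normr0 expr0n.
apply/rowP => k; rewrite mxE; move/eqP: x0.
rewrite -sqrf_eq0 sqr_sqrtr; last by apply: sumr_ge0 => j _; exact: exprn_ge0.
rewrite psumr_eq0 => [|j _]; last exact: exprn_ge0.
by move=> /allP/(_ k (mem_index_enum _)); rewrite /= sqrf_eq0 normr_eq0 => /eqP.
Qed.

Lemma l2norm_le_l1norm n (x : 'rV[R]_n) : l2norm x <= l1norm x.
Proof.
have l1_ge0 : 0 <= l1norm x by apply: sumr_ge0.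
rewrite -(ger0_norm l1_ge0) -sqrtr_sqr ler_wsqrtr// [leRHS]expr2 {1}/l1norm.
rewrite mulr_suml; apply: ler_sum => k _; rewrite expr2 ler_wpM2l//.
by rewrite /l1norm (bigD1 k)//= lerDl sumr_ge0.
Qed.

Lemma norm_coord_le_l2norm n (x : 'rV[R]_n) i : `|x 0 i| <= l2norm x.
Proof.
rewrite -[leLHS]ger0_norm// -sqrtr_sqr ler_wsqrtr// (bigD1 i)//=.
by rewrite lerDl sumr_ge0// => k _; exact: exprn_ge0.
Qed.

Lemma l2norm_mulmx_orthonormal d n (B : 'M[R]_(d, n)) (y : 'rV[R]_d) :
  B *m B^T = 1%:M -> l2norm (y *m B) = l2norm y.
Proof.
move=> BB; apply/eqP; rewrite -(@eqrXn2 _ 2) ?l2norm_ge0// !sqr_l2norm.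
by rewrite trmx_mul mulmxA -(mulmxA y) BB mulmx1.
Qed.

Lemma orthonormal_col_mx n d (v : 'rV[R]_n) (B : 'M[R]_(d, n)) :
  v *m v^T = 1%:M -> B *m B^T = 1%:M -> v *m B^T = 0 ->
  col_mx v B *m (col_mx v B)^T = 1%:M.
Proof.
move=> vv BB vB; rewrite tr_col_mx mul_col_row vv BB vB.
by rewrite -[B *m v^T]trmxK trmx_mul trmxK vB trmx0 -scalar_mx_block.
Qed.

(** Gram-Schmidt by dimension count: while [B] has fewer rows than [\dim E],
    the map [x |-> x *m B^T] has a nonzero kernel in [E], and a unit vector of
    this kernel is the next row. *)
Lemma exists_orthonormal_frame n (E : {vspace 'rV[R]_n}) d : (d <= \dim E)%N ->
  exists2 B : 'M[R]_(d, n), B *m B^T = 1%:M & (forall y, y *m B \in E).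
Proof.
elim: d => [_|d IH dE].
  exists 0; first by rewrite [RHS]flatmx0 [LHS]flatmx0.
  by move=> y; rewrite mulmx0 mem0v.
have [B BB BE] := IH (ltnW dE).
pose phi := linfun (mulmxr B^T : 'rV[R]_n -> 'rV[R]_d).
have dimK : (0 < \dim (E :&: lker phi))%N.
  have le_d : (\dim (phi @: E) <= d)%N.
    by rewrite (leq_trans (dimvS (subvf _)))// dimvf /dim/= mul1n.
  by rewrite -(ltn_add2r (\dim (phi @: E))) limg_ker_dim add0n (leq_ltn_trans le_d).
pose x := vpick (E :&: lker phi)%VS.
have x0 : x != 0 by rewrite vpick0 -dimv_eq0 -lt0n.
have /memv_capP[xE] : x \in (E :&: lker phi)%VS by exact: memv_pick.
rewrite memv_ker lfunE/= => /eqP xB.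
have nx0 : l2norm x != 0 by rewrite l2norm_eq0.
pose v := (l2norm x)^-1 *: x.
have vv : v *m v^T = 1%:M.
  rewrite [LHS]mx11_scalar /v linearZ/= -!scalemxAl -!scalemxAr 2!mxE.
  by rewrite -sqr_l2norm; congr _%:M; field.
have vB : v *m B^T = 0 by rewrite /v -scalemxAl xB scaler0.
exists (col_mx v B : 'M[R]_(1 + d, n)); first exact: orthonormal_col_mx.
move=> y; have -> : y *m (col_mx v B : 'M[R]_(1 + d, n)) =
    @lsubmx _ 1 1 d y *m v + @rsubmx _ 1 1 d y *m B.
  by rewrite -mul_row_col hsubmxK.
rewrite rpredD// [lsubmx _]mx11_scalar mul_scalar_mx scalerA.
exact: rpredZ.
Qed.

(** Both sides are the trace of the projection [B^T *m B], since the trace is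
    invariant under exchanging the two factors. *)
Lemma sum_sqr_l2norm_columns d n (B : 'M[R]_(d, n)) :
  B *m B^T = 1%:M -> \sum_k l2norm (row k B^T) ^+ 2 = d%:R.
Proof.
move=> BB; transitivity (\tr (B^T *m B)).
  apply: eq_bigr => k _; rewrite sqr_l2norm !mxE.
  by apply: eq_bigr => j _; rewrite !mxE.
by rewrite mxtrace_mulC BB mxtrace1.
Qed.

(** Cauchy-Schwarz against the constant vector, in the form that the double
    sum of [(a_i - a_j)^2] is nonnegative. *)
Lemma sum_le_sqrt_sum_sqr n (a : 'I_n -> R) :
  \sum_k a k <= Num.sqrt n%:R * Num.sqrt (\sum_k a k ^+ 2).
Proof.
rewrite -sqrtrM ?ler0n// (le_trans (ler_norm _))// -sqrtr_sqr ler_wsqrtr//.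
rewrite expr2 mulr_suml.
have -> : n%:R * \sum_k a k ^+ 2 =
    \sum_i \sum_j ((a i ^+ 2 + a j ^+ 2) / 2).
  transitivity (\sum_(i < n) (n%:R * a i ^+ 2 + \sum_j a j ^+ 2) / 2).
    rewrite -mulr_suml big_split/= -mulr_sumr sumr_const card_ord mulr_natl.
    by field.
  apply: eq_bigr => i _.
  by rewrite -mulr_suml big_split/= sumr_const card_ord mulr_natl.
apply: ler_sum => i _; rewrite mulr_sumr; apply: ler_sum => j _.
have := sqr_ge0 (a i - a j); nra.
Qed.

End Geometry.

(** * Averaging over signs *)

Section SignAverage.
Context {R : realType}.

(** If the signs are random and independent, the expectation of the right-hand
    side equals the left-hand side, so some choice does at least as well.  The
    proof derandomizes this: each new sign is chosen to make the cross term
    with the sum built so far nonnegative. *)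
Lemma exists_signs_sum_sqr_le n m (u : 'I_n -> 'rV[R]_m) :
  exists2 e : 'I_n -> R, (forall i, `|e i| = 1)
    & \sum_i l2norm (u i) ^+ 2 <= l2norm (\sum_i e i *: u i) ^+ 2.
Proof.
elim: n u => [u|n IH u]; first exists (fun=> 1) => [i|].
- by rewrite normr1.
- by rewrite big_ord0 exprn_ge0// l2norm_ge0.
have [e e1 le_e] := IH (u \o lift ord0).
set w := \sum_i _ *: _ in le_e.
pose s : R := if 0 <= (u ord0 *m w^T) 0 0 then 1 else -1.
have s1 : `|s| = 1 by rewrite /s; case: ifP; rewrite ?normrN normr1.
exists (fun i => oapp e s (unlift ord0 i)) => [i|].
  by case: unliftP => [j|] _ /=.
rewrite !big_ord_recl unlift_none/=.
under [in leRHS]eq_bigr do rewrite liftK/=.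
rewrite -/w.
have ss : s * s = 1 by rewrite /s; case: ifP => _; rewrite ?mulrNN mulr1.
have -> : l2norm (s *: u ord0 + w) ^+ 2 =
    l2norm (u ord0) ^+ 2 + l2norm w ^+ 2 + 2 * (s * (u ord0 *m w^T) 0 0).
  rewrite !sqr_l2norm !mxE !mulr_sumr -!big_split; apply: eq_bigr => k _.
  by rewrite !mxE/=; ring: ss.
have : 0 <= s * (u ord0 *m w^T) 0 0.
  rewrite /s; case: ifPn => [?|]; first by rewrite mul1r.
  by rewrite -ltNge mulN1r oppr_ge0 => /ltW.
move: le_e; rewrite /comp; lra.
Qed.

Lemma mulmx_signs_le_l1norm n (x e : 'rV[R]_n) :
  (forall i, `|e 0 i| = 1) -> (x *m e^T) 0 0 <= l1norm x.
Proof.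
move=> e1; rewrite mxE (le_trans (ler_norm _))// (le_trans (ler_norm_sum _ _ _))//.
by apply: ler_sum => k _; rewrite mxE normrM e1 mulr1.
Qed.

(** Tested on the projection onto [E] of a well chosen vector of signs. *)
Lemma l1norm_upper_bound_ge N d (E : {vspace 'rV[R]_N}) (lambda : R) :
  (1 <= d)%N -> (d <= \dim E)%N ->
  (forall x : 'rV[R]_N, x \in E -> l1norm x <= lambda * l2norm x) ->
  Num.sqrt d%:R <= lambda.
Proof.
move=> d1 dE hE; have [B BB BE] := exists_orthonormal_frame dE.
have [e e1 le_e] := exists_signs_sum_sqr_le (fun k => row k B^T).
rewrite sum_sqr_l2norm_columns// in le_e.
pose s := \row_k e k : 'rV[R]_N.
set y := \sum_k _ *: _ in le_e.
have yE : y = s *m B^T.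
  by rewrite mulmx_sum_row; apply: eq_bigr => k _; rewrite mxE.
have y0 : 0 < l2norm y.
  rewrite lt_neqAle l2norm_ge0 andbT eq_sym; apply/eqP => y0.
  by move: le_e; rewrite y0 expr0n/= lern0 -leqn0 leqNgt d1.
have : Num.sqrt d%:R <= l2norm y.
  by rewrite -[leRHS]ger0_norm ?l2norm_ge0// -sqrtr_sqr ler_wsqrtr.
move=> /le_trans; apply.
rewrite -(ler_pM2r y0) -expr2.
rewrite -[X in _ <= lambda * X](l2norm_mulmx_orthonormal _ BB).
apply: le_trans (hE _ (BE _)).
have -> : l2norm y ^+ 2 = (y *m B *m s^T) 0 0.
  by rewrite sqr_l2norm -mulmxA {2}yE trmx_mul trmxK.
by apply: mulmx_signs_le_l1norm => k; rewrite mxE.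
Qed.

End SignAverage.

(** * Gaussian integrals *)

Section Gaussian.
Context {R : realType}.
Local Notation leb := (@lebesgue_measure R).
Local Notation gamma := (normal_prob (0 : R) 1).

(** The normal density agrees almost everywhere with the Radon-Nikodym
    derivative, for which the change of measure is known. *)
Lemma ge0_integral_normal_prob (m s : R) (f : R -> \bar R) :
  measurable_fun [set: R] f -> (forall x, 0 <= f x)%E ->
  (\int[normal_prob m s]_x f x = \int[leb]_x (f x * (normal_pdf m s x)%:E))%E.
Proof.
move=> mf f0; have dom := normal_prob_dominates m s.
rewrite -(Radon_Nikodym_SigmaFinite.change_of_variables dom)//.
have fi := Radon_Nikodym_SigmaFinite.f_integrable dom.
apply: ae_eq_integral => //.
- by apply: emeasurable_funM => //; exact: (measurable_int leb fi).
- apply: emeasurable_funM => //.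
  by apply: measurableT_comp => //; exact: measurable_normal_pdf.
have : ae_eq leb setT
    (Radon_Nikodym_SigmaFinite.f (normal_prob m s) leb)
    (fun x => (normal_pdf m s x)%:E).
  apply: integral_ae_eq => //=.
    by apply: measurableT_comp => //; exact: measurable_normal_pdf.
  by move=> A _ mA; rewrite -Radon_Nikodym_SigmaFinite.f_integral.
by apply: filterS => x /= fx /fx ->.
Qed.

Lemma ge0_integral_oppr (f : R -> \bar R) :
  measurable_fun [set: R] f -> (forall x, 0 <= f x)%E ->
  (\int[leb]_x f (- x)%R = \int[leb]_x f x)%E.
Proof.
move=> mf f0.
transitivity (\int[pushforward leb
    (-%R : measurableTypeR R -> measurableTypeR R)]_x f x)%E.
  by rewrite ge0_integral_pushforward//=; exact: (@measurable_oppr R).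
by apply: eq_measure_integral => //= A mA _; exact: lebesgue_measureN.
Qed.

Lemma ge0_integral_normal_oppr (f : R -> \bar R) :
  measurable_fun [set: R] f -> (forall x, 0 <= f x)%E ->
  (\int[gamma]_x f (- x)%R = \int[gamma]_x f x)%E.
Proof.
move=> mf f0; rewrite !ge0_integral_normal_prob//; last first.
  by apply: measurableT_comp => //; exact: (@measurable_oppr R).
rewrite -[RHS]ge0_integral_oppr.
- apply: eq_integral => x _; congr (_ * _%:E)%E.
  by rewrite !normal_pdfE// /normal_fun !subr0 sqrrN.
- apply: emeasurable_funM => //.
  by apply: measurableT_comp => //; exact: measurable_normal_pdf.
- by move=> x; rewrite mule_ge0// lee_fin normal_pdf_ge0.
Qed.

Lemma normal_peak_scale (s : R) : 0 < s -> normal_peak s = normal_peak 1 / s.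
Proof.
move=> s0; rewrite /normal_peak expr1n mul1r -mulrnAr sqrtrM ?sqr_ge0//.
by rewrite sqrtr_sqr gtr0_norm// invfM mulrC.
Qed.

Lemma normal_pdf_affine (c s z : R) : 0 < s ->
  normal_pdf c s (c + s * z) * s = normal_pdf 0 1 z.
Proof.
move=> s0; have s_neq0 : s != 0 by rewrite gt_eqF.
rewrite !normal_pdfE// normal_peak_scale// mulrAC divfK//; congr (_ * _).
by rewrite /normal_fun; congr expR; field.
Qed.

Lemma integral_normal_affine (f : R -> R) (c s : R) : 0 < s ->
  continuous f -> (forall x, 0 <= f x) ->
  (\int[gamma]_z (f (c + s * z))%:E =
   \int[leb]_u (f u * normal_pdf c s u)%:E)%E.
Proof.
move=> s0 cf f0; pose F (z : R) := c + s * z.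
have dF (z : R) : is_derive z (1 : R) F s.
  by rewrite /F; apply: is_derive_eq; rewrite add0r mul1r; exact: mulr1.
have cF : continuous F.
  by move=> z; apply/differentiable_continuous/derivable1_diffP.
have F' : (F^`())%classic = cst s.
  by apply/funext => z; rewrite derive1E derive_val.
rewrite ge0_integral_normal_prob; first last.
- by move=> z; rewrite lee_fin.
- apply/measurable_EFinP; apply: continuous_measurable_fun => z.
  exact: (continuous_comp (cF z) (cf (F z))).
rewrite [RHS](@increasing_ge0_integration_by_substitutionT _ F).
- apply: eq_integral => z _; rewrite F' !fctE -EFinM -mulrA /F.
  by rewrite normal_pdf_affine.
- by move=> x y xy; rewrite ltrD2l ltr_pM2l.
- by rewrite F' => z; exact: cst_continuous.
- by rewrite F'; exact: is_cvg_cst.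
- by rewrite F'; exact: is_cvg_cst.
- by [].
- by apply: cvg_comp (cvg_addrl_Ny c); exact: gt0_cvgMrNy.
- by apply: cvg_comp (cvg_addrl c); exact: gt0_cvgMry.
- move=> z; apply: continuousM; first exact: cf.
  by apply: continuous_normal_pdf; rewrite gt_eqF.
- by move=> z; rewrite mulr_ge0// normal_pdf_ge0.
Qed.

(** The joint density of [(x, u)], where [u = a * x + b * y] with [x] and [y]
    independent standard normals, factored in the two possible orders: [x] first
    and then [u] given [x], or [u] first and then [x] given [u].  The second
    order exhibits [u] as a normal variable of variance [s ^+ 2]. *)
Lemma normal_pdf_mul (a b s x u : R) :
  0 < b -> 0 < s -> s ^+ 2 = a ^+ 2 + b ^+ 2 ->
  normal_pdf 0 1 x * normal_pdf (a * x) b u =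
  normal_pdf 0 s u * normal_pdf (a * u / s ^+ 2) (b / s) x.
Proof.
move=> b0 s0 ss.
have [b_neq0 s_neq0] : b != 0 /\ s != 0 by split; rewrite gt_eqF.
have bs_gt0 : 0 < b / s by rewrite divr_gt0.
rewrite !normal_pdfE ?gt_eqF//.
rewrite (normal_peak_scale b0) (normal_peak_scale s0) (normal_peak_scale bs_gt0).
rewrite mulrACA [RHS]mulrACA; congr (_ * _); first by field; apply/andP.
rewrite /normal_fun -!expRD; congr expR.
rewrite expr_div_n ss; field.
by rewrite -ss sqrf_eq0 s_neq0 b_neq0.
Qed.

Lemma normal_pdf_center (m s x : R) : s != 0 ->
  normal_pdf m s x = normal_pdf 0 s (x - m).
Proof. by move=> s0; rewrite !normal_pdfE// /normal_fun subr0. Qed.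

(** The law of [a * x + b * y] for independent standard normals.  Substituting
    [u = a * x + b * y] for [y] and exchanging the integrals leaves, for each
    [u], the integral of the conditional density of [x] given [u], which is 1. *)
Lemma integral_normal_add (f : R -> R) (a b : R) : 0 <= b ->
  continuous f -> (forall x, 0 <= f x) ->
  (\int[gamma]_x \int[gamma]_y (f (a * x + b * y))%:E =
   \int[gamma]_z (f (Num.sqrt (a ^+ 2 + b ^+ 2) * z))%:E)%E.
Proof.
rewrite le_eqVlt => /predU1P[<-|b0] cf f0; last first.
  pose s := Num.sqrt (a ^+ 2 + b ^+ 2).
  have s0 : 0 < s by rewrite sqrtr_gt0; nra.
  have mf : measurable_fun [set: R] f := continuous_measurable_fun cf.
  have ss : s ^+ 2 = a ^+ 2 + b ^+ 2 by rewrite sqr_sqrtr// addr_ge0 ?sqr_ge0.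
  pose h (p : measurableTypeR R * measurableTypeR R) : \bar R :=
    (f p.2 * normal_pdf (a * p.1) b p.2)%:E.
  have h0 p : (0 <= h p)%E by rewrite lee_fin mulr_ge0// normal_pdf_ge0.
  have mh : measurable_fun setT h.
    apply/measurable_EFinP/measurable_funM; first exact: measurableT_comp.
    under eq_fun do rewrite normal_pdf_center ?gt_eqF//.
    apply: measurableT_comp; first exact: measurable_normal_pdf.
    by apply: measurable_funB => //; exact: measurable_funM.
  transitivity (\int[gamma]_x \int[leb]_u h (x, u))%E.
    by apply: eq_integral => x _; rewrite integral_normal_affine.
  rewrite (fubini_tonelli (m1 := gamma) (m2 := leb) h mh h0).
  under [RHS]eq_integral do rewrite -[_ * _]add0r.
  rewrite integral_normal_affine//; apply: eq_integral => u _.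
  rewrite ge0_integral_normal_prob//; last first.
    exact: (measurableT_comp mh (measurable_pair2 u)).
  transitivity (\int[leb]_x ((f u * normal_pdf 0 s u)%:E *
                  (normal_pdf (a * u / s ^+ 2) (b / s) x)%:E))%E.
    apply: eq_integral => x _; rewrite /h/= -!EFinM; congr _%:E.
    rewrite -[LHS]mulrA -[RHS]mulrA; congr (_ * _); rewrite [LHS]mulrC.
    exact: normal_pdf_mul.
  rewrite ge0_integralZl//.
  + by rewrite integral_normal_pdf mule1.
  + by apply/measurable_EFinP; exact: measurable_normal_pdf.
  + by move=> x _; rewrite lee_fin normal_pdf_ge0.
  + by rewrite lee_fin mulr_ge0// normal_pdf_ge0.
(* For b = 0 the law of u given x has no density; the reflection z |-> - z turns a
   into its absolute value. *)
have mfa (c : R) : measurable_fun [set: R] (fun z => (f (c * z))%:E).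
  apply/measurable_EFinP/measurableT_comp; first exact: continuous_measurable_fun.
  exact: measurable_funM.
transitivity (\int[gamma]_x (f (a * x))%:E)%E.
  apply: eq_integral => x _; under eq_integral do rewrite mul0r addr0.
  by rewrite integral_cst// [X in (_ * X)%E](@probability_setT _ _ _ gamma) mule1.
rewrite expr0n/= addr0 sqrtr_sqr.
have [a0|a0] := leP 0 a; first by rewrite ger0_norm.
rewrite ltr0_norm// -(ge0_integral_normal_oppr (mfa a)) => [|x].
  by apply: eq_integral => x _; rewrite mulrN mulNr.
by rewrite lee_fin.
Qed.

Lemma integral_normal_norm (s : R) : 0 <= s ->
  (\int[gamma]_z `|s * z|%:E = (s * Num.sqrt (2 / pi))%:E)%E.
Proof.
move=> s0.
have m_norm : measurable_fun [set: R] (fun z : R => `|z|%:E).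
  apply/measurable_EFinP; apply: continuous_measurable_fun.
  exact: norm_continuous.
transitivity (s%:E * \int[gamma]_z `|z|%:E)%E.
  rewrite -ge0_integralZl//.
  by apply: eq_integral => z _; rewrite normrM ger0_norm.
rewrite EFinM; congr (_ * _)%E.
rewrite ge0_integral_normal_prob//.
pose k z : R := `|z| * normal_pdf 0 1 z.
transitivity (\int[leb]_z (k z)%:E)%E; first by [].
have ck : continuous k.
  move=> z; apply: continuousM; first exact: norm_continuous.
  exact: continuous_normal_pdf.
have k0 z : 0 <= k z by rewrite mulr_ge0// normal_pdf_ge0.
rewrite ge0_symfun_integralT//; last first.
  by move=> z; rewrite /k /= normrN !normal_pdfE// /normal_fun !subr0 sqrrN.
rewrite -set_itvcy.
have pdfE z : normal_pdf 0 1 z = normal_peak 1 * expR (- (z ^+ 2 / 2)).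
  by rewrite normal_pdfE// /normal_fun subr0 expr1n mulNr.
pose F (z : R) := - (normal_peak 1 * expR (- (z ^+ 2 / 2))).
(* F is minus the density itself, which is an antiderivative of
   z * normal_pdf 0 1 z. *)
have dF (z : R) : is_derive z (1 : R) F (z * normal_pdf 0 1 z).
  rewrite /F pdfE; apply: is_derive_eq.
  by rewrite /GRing.scale/=; field.
have cF : continuous F.
  by move=> z; apply/differentiable_continuous/derivable1_diffP.
rewrite (@ge0_continuous_FTC2y _ _ F 0 0)//.
- rewrite sub0e -EFinN opprK -EFinM; congr _%:E.
  rewrite expr0n/= mul0r oppr0 expR0 mulr1 /normal_peak expr1n mul1r.
  rewrite -[pi *+ 2]mulr_natr !sqrtrM ?pi_ge0// sqrtrV ?pi_ge0//.
  have {1}-> : 2 = Num.sqrt 2 ^+ 2 :> R by rewrite sqr_sqrtr.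
  by field; rewrite !gt_eqF// sqrtr_gt0// pi_gt0.
- exact: continuous_subspaceT.
- rewrite -oppr0 -(mulr0 (normal_peak 1)); apply: cvgN.
  apply: cvgM; first exact: cvg_cst.
  apply: (cvg_comp (fun z : R => z ^+ 2 / 2) (fun y => expR (- y))); last exact: cvgr_expR.
  by apply: gt0_cvgMly; [|exact: cvgr_expr2].
- by apply: cvg_at_right_filter; exact: cF.
- move=> z; rewrite in_itv/= andbT => z0; rewrite derive1E derive_val /k.
  by rewrite gtr0_norm.
Qed.

Lemma measurable_tuple_linear n (v : 'rV[R]_n) :
  measurable_fun setT (fun t : n.-tuple (measurableTypeR R) =>
    \sum_i tnth t i * v 0 i).
Proof.
apply: measurable_sum => i.
by apply: measurable_funM => //; exact: measurable_tnth.
Qed.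

(** A linear form of a standard Gaussian vector is distributed as a standard
    normal scaled by the norm of its coefficient vector.  In the inductive step
    the first coordinate is frozen and merged into the test function, which is
    why the statement quantifies over all continuous [f]. *)
Lemma integral_gaussian_linear n (v : 'rV[R]_n) (f : R -> R) :
  continuous f -> (forall x, 0 <= f x) ->
  (\int[gaussian R n]_t (f (\sum_i tnth t i * v 0 i))%:E =
   \int[gamma]_z (f (l2norm v * z))%:E)%E.
Proof.
elim: n v f => [|n IH] v f cf f0.
  rewrite /gaussian/= integral_dirac//=; last first.
    apply/measurable_EFinP/measurableT_comp; last exact: measurable_tuple_linear.
    exact: continuous_measurable_fun.
  rewrite diracT mul1e big_ord0 /l2norm big_ord0 sqrtr0.
  under eq_integral do rewrite mul0r.
  by rewrite integral_cst// [X in (_ * X)%E](@probability_setT _ _ _ gamma) mule1.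
have mf : measurable_fun [set: R] f := continuous_measurable_fun cf.
have msum : measurable_fun setT (fun t : n.+1.-tuple (measurableTypeR R) =>
    (f (\sum_i tnth t i * v 0 i))%:E).
  by apply/measurable_EFinP/measurableT_comp => //; exact: measurable_tuple_linear.
rewrite /gaussian/= ge0_integral_distribution//; last first.
  by move=> t; rewrite lee_fin.
rewrite fubini_tonelli1/=; first last.
- by move=> p; rewrite lee_fin.
- exact: (measurableT_comp msum (@measurable_tcons _ (measurableTypeR R) n)).
pose v' : 'rV[R]_n := \row_i v 0 (lift ord0 i).
transitivity (\int[gamma]_x \int[gamma]_z (f (v 0 ord0 * x + l2norm v' * z))%:E)%E.
  apply: eq_integral => x _; rewrite /fubini_F/=.
  rewrite -[RHS](IH v' (fun y => f (v 0 ord0 * x + y))).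
  + apply: eq_integral => t _ /=; congr (f _)%:E.
    rewrite big_ord_recl mulrC; congr (_ + _); apply: eq_bigr => i _.
    by rewrite /tcons mxE tnthS.
  + move=> y; apply: (continuous_comp _ (cf _)).
    by apply: continuousD; [exact: cst_continuous|].
  + by [].
rewrite integral_normal_add//; last exact: sqrtr_ge0.
suff -> : Num.sqrt (v 0 ord0 ^+ 2 + l2norm v' ^+ 2) = l2norm v by [].
rewrite /l2norm sqr_sqrtr; last by apply: sumr_ge0 => j _; exact: exprn_ge0.
rewrite big_ord_recl real_normK ?num_real//; congr (Num.sqrt (_ + _)).
by apply: eq_bigr => i _; rewrite mxE.
Qed.

End Gaussian.

(** * Averaging over the Gaussian measure *)

Section GaussianAverage.
Context {R : realType}.

Lemma measurable_tuple_l2norm d :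
  measurable_fun setT
    (fun t : d.-tuple (measurableTypeR R) => l2norm (\row_i tnth t i)).
Proof.
apply: (@measurableT_comp _ _ _ _ _ _ (@Num.sqrt R)).
  by apply: continuous_measurable_fun; exact: sqrt_continuous.
apply: measurable_sum => k; under eq_fun do rewrite mxE.
apply: measurable_funX; apply: measurableT_comp => //; exact: measurable_tnth.
Qed.

Lemma integral_gaussian_norm_linear d (v : 'rV[R]_d) :
  (\int[gaussian R d]_t `|\sum_i tnth t i * v 0 i|%:E =
   (l2norm v * Num.sqrt (2 / pi))%:E)%E.
Proof.
rewrite (integral_gaussian_linear v (f := fun x : R => `|x|))//.
  by rewrite integral_normal_norm ?l2norm_ge0.
exact: norm_continuous.
Qed.

Lemma measurable_tuple_norm_linear d (v : 'rV[R]_d) :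
  measurable_fun setT (fun t : d.-tuple (measurableTypeR R) =>
    `|\sum_i tnth t i * v 0 i|%:E).
Proof.
apply/measurable_EFinP/measurableT_comp => //.
exact: measurable_tuple_linear.
Qed.

Lemma integral_gaussian_l1norm d N (B : 'M[R]_(d, N)) :
  (\int[gaussian R d]_t (l1norm (\row_i tnth t i *m B))%:E =
   (\sum_k l2norm (row k B^T) * Num.sqrt (2 / pi))%:E)%E.
Proof.
under eq_integral => t _.
  rewrite /l1norm -sumEFin; under eq_bigr => k _.
    rewrite (_ : (_ *m B) 0 k = \sum_i tnth t i * (row k B^T) 0 i); last first.
      by rewrite mxE; apply: eq_bigr => i _; rewrite !mxE.
    over.
  over.
rewrite ge0_integral_sum//= => [|k]; last exact: measurable_tuple_norm_linear.
rewrite -sumEFin; apply: eq_bigr => k _; exact: integral_gaussian_norm_linear.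
Qed.

Lemma measurable_tuple_l1norm d N (B : 'M[R]_(d, N)) :
  measurable_fun setT (fun t : d.-tuple (measurableTypeR R) =>
    (l1norm (\row_i tnth t i *m B))%:E).
Proof.
apply/measurable_EFinP; apply: measurable_sum => k; apply: measurableT_comp => //.
under eq_fun do rewrite mxE.
apply: measurable_sum => i; under eq_fun do rewrite mxE.
by apply: measurable_funM => //; exact: measurable_tnth.
Qed.

(** [mu] is defined through [fine], so this identity carries the finiteness of
    the expectation; it follows from [l2norm_le_l1norm]. *)
Lemma integral_gaussian_l2norm d :
  (\int[gaussian R d]_t (l2norm (\row_i tnth t i))%:E = (mu R d)%:E)%E.
Proof.
have ml2 := @measurable_tuple_l2norm d.
rewrite /mu expectation.unlock fineK// ge0_fin_numE; last first.
  by apply: integral_ge0 => t _; rewrite lee_fin l2norm_ge0.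
apply: (@le_lt_trans _ _
    (\int[gaussian R d]_t (l1norm (\row_i tnth t i *m 1%:M))%:E)%E).
  apply: ge0_le_integral => //.
  - by move=> t _; rewrite lee_fin l2norm_ge0.
  - exact/measurable_EFinP.
  - exact: measurable_tuple_l1norm.
  - by move=> t _; rewrite lee_fin mulmx1 l2norm_le_l1norm.
by rewrite integral_gaussian_l1norm ltry.
Qed.

(** The norm of the Gaussian vector dominates its first coordinate, whose
    mean absolute value is positive. *)
Lemma mu_gt0 d : (0 < d)%N -> 0 < mu R d.
Proof.
case: d => // d _; pose v : 'rV[R]_d.+1 := delta_mx 0 0.
apply: (@lt_le_trans _ _ (l2norm v * Num.sqrt (2 / pi))).
  apply: mulr_gt0; last by rewrite sqrtr_gt0 divr_gt0 ?pi_gt0.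
  rewrite lt_neqAle l2norm_ge0 andbT eq_sym l2norm_eq0.
  by apply/eqP => /rowP/(_ 0); rewrite !mxE !eqxx => /eqP; rewrite oner_eq0.
rewrite -lee_fin -integral_gaussian_norm_linear -integral_gaussian_l2norm.
apply: ge0_le_integral => //.
- exact: measurable_tuple_norm_linear.
- by apply/measurable_EFinP; exact: measurable_tuple_l2norm.
- move=> t _; rewrite lee_fin; apply: le_trans (norm_coord_le_l2norm _ 0).
  rewrite (bigD1 0)//= big1 => [|i i0]; last first.
    by rewrite !mxE (negbTE i0) andbF mulr0.
  by rewrite !mxE !eqxx mulr1 addr0.
Qed.

(** Tested on the Gaussian vectors of [E], with the two sides integrated. *)
Lemma l1norm_lower_bound_le N d (E : {vspace 'rV[R]_N}) (lambda : R) :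
  (1 <= d)%N -> (d <= \dim E)%N ->
  (forall x : 'rV[R]_N, x \in E -> lambda * l2norm x <= l1norm x) ->
  lambda <= Num.sqrt (2 / pi) * Num.sqrt N%:R * (Num.sqrt d%:R / mu R d).
Proof.
move=> d1 dE hE; have mu0 := mu_gt0 d1.
have [l0|l0] := leP lambda 0.
  by rewrite (le_trans l0)// !mulr_ge0// invr_ge0 ltW.
have [B BB BE] := exists_orthonormal_frame dE.
rewrite mulrA ler_pdivlMr//.
apply: (@le_trans _ _ (\sum_k l2norm (row k B^T) * Num.sqrt (2 / pi))).
  rewrite -lee_fin EFinM -integral_gaussian_l2norm -integral_gaussian_l1norm.
  have ml2 := @measurable_tuple_l2norm d.
  rewrite -ge0_integralZl//; first last.
  - by rewrite lee_fin ltW.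
  - by move=> t _; rewrite lee_fin l2norm_ge0.
  - exact/measurable_EFinP.
  apply: ge0_le_integral => //.
  - by move=> t _; rewrite lee_fin mulr_ge0 ?l2norm_ge0// ltW.
  - by apply/measurable_EFinP/measurable_funM.
  - exact: measurable_tuple_l1norm.
  - move=> t _; rewrite -EFinM lee_fin -(l2norm_mulmx_orthonormal _ BB).
    exact: hE.
rewrite -mulr_suml mulrC -mulrA ler_wpM2l// -(sum_sqr_l2norm_columns BB).
exact: sum_le_sqrt_sum_sqr.
Qed.

End GaussianAverage.

Unset Implicit Arguments.

Theorem theorem2p1 (R : realType) (N d : nat) (E : {vspace 'rV[R]_N})
    (lambda lambda' : R) :
  (1 <= d)%N -> (d <= N)%N -> \dim E = d ->
  ((forall x : 'rV[R]_N, x \in E -> lambda * l2norm x <= l1norm x) ->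
     lambda <= Num.sqrt (2 / pi) * Num.sqrt N%:R * (Num.sqrt d%:R / mu R d))
  /\
  ((forall x : 'rV[R]_N, x \in E -> l1norm x <= lambda' * l2norm x) ->
     Num.sqrt d%:R <= lambda').
Proof.
move=> d1 _ dimE; have dE : (d <= \dim E)%N by rewrite dimE.
split; [exact: l1norm_lower_bound_le | exact: l1norm_upper_bound_ge].
Qed.
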